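(* Let $k\geqslant 1$ be an integer and let $S$ be a set of $n$ points in $\mathbb{R}^3$ such that no three points of $S$ are collinear and at most $n-k$ points of $S$ lie on any common plane. If $n\geqslant 54k^2+\frac{9}{2}k$, then the number $m$ of planes determined by $S$ satisfies \[ m\geqslant 1 + k \binom{n-k}{2}-\binom{k}{2}\left(\frac{n-k}{2}\right). \]
   Context: A plane is determined by $S$ if it contains at least three points of $S$; $m$ is the total number of such planes. *)

(* Defs.v *)
From HB Require Import structures.
From mathcomp Require Import all_boot all_order all_algebra finmap.
From mathcomp Require Import all_classical all_reals.
Set Implicit Arguments.
Unset Strict Implicit.
Unset Printing Implicit Defensive.
Import Order.TTheory GRing.Theory Num.Theory.
Local Open Scope classical_set_scope.
Local Open Scope fset_scope.
Local Open Scope ring_scope.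

Definition is_flat (R : realType) (d : nat) (P : set 'rV[R]_3) : Prop :=
  exists (p : 'rV[R]_3) (U : {vspace 'rV[R]_3}),
    \dim U = d /\ P = [set x | x - p \in U].

Definition is_line (R : realType) (L : set 'rV[R]_3) : Prop := is_flat 1 L.

Definition is_plane (R : realType) (P : set 'rV[R]_3) : Prop := is_flat 2 P.

Definition points_on (R : realType) (S : {fset 'rV[R]_3})
    (P : set 'rV[R]_3) : {fset 'rV[R]_3} :=
  [fset x in S | x \in P].

Definition collinear (R : realType) (x y z : 'rV[R]_3) : Prop :=
  exists L : set 'rV[R]_3, [/\ is_line L, L x, L y & L z].

Definition no_three_collinear (R : realType) (S : {fset 'rV[R]_3}) : Prop :=
  forall x y z : 'rV[R]_3, x \in S -> y \in S -> z \in S ->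
    x != y -> y != z -> x != z -> ~ collinear x y z.

Definition determined_planes (R : realType) (S : {fset 'rV[R]_3}) :
    set (set 'rV[R]_3) :=
  [set P | is_plane P /\ (3 <= #|` points_on S P|)%N].

(* [fset_set] sends an infinite set to [fset0]. When no three points of [S] are
   collinear, three points of [S] lie on exactly one plane, so
   [determined_planes S] is finite and this is its cardinality. *)
Definition num_determined_planes (R : realType) (S : {fset 'rV[R]_3}) : nat :=
  #|` fset_set (determined_planes S)|.

(* Main.v *)
Require Import Defs.
From mathcomp Require Import all_boot all_order all_algebra finmap.
From mathcomp Require Import all_classical all_reals.
From mathcomp Require Import zify ring lra.
Import Order.TTheory GRing.Theory Num.Theory.
Local Open Scope ring_scope.
Set Implicit Arguments.
Unset Strict Implicit.

(* Projecting from a point p of S and dualizing, the other points become lines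
   of pairwise distinct slopes in a plane, and the determined planes through p
   become the vertices of this arrangement. Sending each face to a vertex
   in the interior of its upper or lower boundary gives a weak form of
   Melchior's inequality, with error term n - 1; summed over p it reads
   sum_P |P|(|P| - 4) <= n(n - 1).
   Let d(p, q) be the number of determined planes through p and q, so that
   sum_P |P|(|P| - 1) = sum_(p <> q) d(p, q). If for every p at most one q has
   d(p, q) <= 6k + 1, this sum is at least n(n - 2)(6k + 2); it is also at most
   12 m + 7 n(n - 1) / 4, and the bound on m follows. Otherwise d(p, q) and
   d(p, q') are at most 6k + 1 for some p and some q <> q'. A point off the plane
   pqq' is determined by its two planes through pq and pq', so only
   x <= 36 k^2 points lie off that plane. Inclusion-exclusion on the planes
   joining these points to pairs of points of the plane gives
   4 m >= 4 + x(n - x)(2n - 3x - 1); for k <= x <= 36 k^2 the right-hand side is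
   smallest at x = k, where it is four times the claimed bound. *)

(** Choosing a related element for each member of [X] gives an injection. The relational form suits
    targets found by a case analysis or as a minimum. *)
Lemma leq_card_rel (T1 T2 : finType) (X : {set T1}) (Y : {set T2})
    (r : T1 -> T2 -> Prop) :
  (forall x, x \in X -> exists2 y, y \in Y & r x y) ->
  (forall x x' y, x \in X -> x' \in X -> y \in Y -> r x y -> r x' y -> x = x') ->
  (#|X| <= #|Y|)%N.
Proof.
move=> rX rI.
case: (set_0Vmem Y) => [Y0|[y0 _]].
  rewrite (_ : X = finset.set0) ?cards0 //; apply/setP => x; rewrite inE.
  by apply/negP => /rX [y]; rewrite Y0 inE.
have [f fP] : {f : T1 -> T2 & forall x, x \in X -> f x \in Y /\ r x (f x)}.
  apply: (@boolp.choice _ _ (fun x y => x \in X -> y \in Y /\ r x y)) => x.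
  case: (boolP (x \in X)) => [/rX [y yY rxy]|xX]; last by exists y0.
  by exists y.
have fI : {in X &, injective f}.
  move=> x x' xX x'X e; apply: (rI x x' (f x)) => //; [by case: (fP x xX)..|].
  by rewrite e; case: (fP x' x'X).
rewrite -(card_in_imset fI); apply: subset_leq_card.
by apply/fintype.subsetP => _ /imsetP [x xX ->]; case: (fP x xX).
Qed.

(** * Heights of two lines compared at two abscissae *)

Section Lines.
Variables (F : realFieldType) (t1 s1 t2 s2 : F).

Lemma slope_lt (a b : F) : a < b -> t1 + s1 * a <= t2 + s2 * a ->
  t2 + s2 * b < t1 + s1 * b -> s2 < s1.
Proof.
move=> ab ha hb; rewrite ltNge; apply/negP => h.
have : 0 <= (s2 - s1) * (b - a) by rewrite mulr_ge0 ?subr_ge0 // ltW.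
rewrite mulrBr !mulrBl; lra.
Qed.

Lemma slope_le (a b : F) : a < b -> t1 + s1 * a <= t2 + s2 * a ->
  t2 + s2 * b <= t1 + s1 * b -> s2 <= s1.
Proof.
move=> ab ha hb; rewrite leNgt; apply/negP => h.
have : 0 < (s2 - s1) * (b - a) by rewrite mulr_gt0 ?subr_gt0.
rewrite mulrBr !mulrBl; lra.
Qed.

Lemma line_le_right (e a : F) : s2 <= s1 -> t1 + s1 * e = t2 + s2 * e ->
  e <= a -> t2 + s2 * a <= t1 + s1 * a.
Proof.
move=> h he ea.
have : 0 <= (s1 - s2) * (a - e) by rewrite mulr_ge0 ?subr_ge0.
rewrite mulrBr !mulrBl; lra.
Qed.

Lemma line_lt_right (e a : F) : s2 < s1 -> t1 + s1 * e = t2 + s2 * e ->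
  e < a -> t2 + s2 * a < t1 + s1 * a.
Proof.
move=> h he ea.
have : 0 < (s1 - s2) * (a - e) by rewrite mulr_gt0 ?subr_gt0.
rewrite mulrBr !mulrBl; lra.
Qed.

Lemma line_le_left (e a : F) : s2 <= s1 -> t1 + s1 * e = t2 + s2 * e ->
  a <= e -> t1 + s1 * a <= t2 + s2 * a.
Proof.
move=> h he ea.
have : 0 <= (s1 - s2) * (e - a) by rewrite mulr_ge0 ?subr_ge0.
rewrite mulrBr !mulrBl; lra.
Qed.

Lemma line_lt_left (e a : F) : s2 < s1 -> t1 + s1 * e = t2 + s2 * e ->
  a < e -> t1 + s1 * a < t2 + s2 * a.
Proof.
move=> h he ea.
have : 0 < (s1 - s2) * (e - a) by rewrite mulr_gt0 ?subr_gt0.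
rewrite mulrBr !mulrBl; lra.
Qed.
End Lines.

(** * A weak Melchior inequality for arrangements of lines *)

Section Arrangement.
Variables (F : realFieldType) (I : finType) (A : {set I}) (V : {set {set I}}).
Variable x : {set I} -> F.

(** Line [l] has slope [s l] and intercept [t l]; a vertex is encoded as the set [B] of lines
    through the point ([x B], [y B]). Only [x] is fixed in the section, so that the picture can be
    reflected in the horizontal axis. *)
Definition blocks (s t : I -> F) (y : {set I} -> F) :=
  forall B l, B \in V -> (l \in B) = (l \in A) && (t l + s l * x B == y B).

(* The wedge to the right of the vertex [B] between the lines [i] and [j] of
   consecutive slopes through it. *)
Definition corner (s : I -> F) (B : {set I}) (i j : I) :=
  [/\ i \in B, j \in B, s i < s j & forall l, l \in B -> s i < s l -> s l < s j -> False].

Definition clear_until (B : {set I}) (i j : I) (w : F) :=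
  forall E : {set I}, E \in V -> x B < x E -> (i \in E) || (j \in E) -> w <= x E.

Hypothesis cover : forall i j, i \in A -> j \in A -> i != j ->
  exists B : {set I}, [/\ B \in V, i \in B & j \in B].

(** Suppose [l] differs from [j] and follow it back from [x D] to [x B]. If it is below [B] there,
    it crosses [i] strictly in between; if above, it crosses [j] in between, the last hypothesis
    ruling out a crossing at [x D] itself. By [cover] such a crossing is a vertex, against
    [clear_until]. If it passes through [B], its slope separates two consecutive ones. The last
    hypothesis says that [l] is not above [j] just left of [D]. *)
Lemma corner_unique (s t : I -> F) (y : {set I} -> F) (B D : {set I}) (i j l : I) :
  blocks s t y -> {in A &, injective s} -> B \in V -> D \in V ->
  corner s B i j -> x B < x D -> i \in D -> clear_until B i j (x D) ->
  l \in A -> y D < t l + s l * x D ->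
  t l + s l * x D <= t j + s j * x D ->
  (t l + s l * x D = t j + s j * x D -> s j <= s l) -> l = j.
Proof.
move=> bl sI BV DV [iB jB sij nbt] xBD iD clr lA lD lj ljs.
have [iA /eqP hiB] : i \in A /\ t i + s i * x B == y B by apply/andP; rewrite -bl.
have [jA /eqP hjB] : j \in A /\ t j + s j * x B == y B by apply/andP; rewrite -bl.
have [_ /eqP hiD] : i \in A /\ t i + s i * x D == y D by apply/andP; rewrite -bl.
apply/eqP; apply: contraT => nlj.
have nli : l != i by apply/eqP => e; move: lD; rewrite e hiD ltxx.
have [E1 [E1V lE1 iE1]] := cover lA iA nli.
have [E2 [E2V lE2 jE2]] := cover lA jA nlj.
have /andP[_ /eqP l1] : (l \in A) && (t l + s l * x E1 == y E1) by rewrite -bl.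
have /andP[_ /eqP i1] : (i \in A) && (t i + s i * x E1 == y E1) by rewrite -bl.
have /andP[_ /eqP l2] : (l \in A) && (t l + s l * x E2 == y E2) by rewrite -bl.
have /andP[_ /eqP j2] : (j \in A) && (t j + s j * x E2 == y E2) by rewrite -bl.
have c1 := clr E1 E1V; have c2 := clr E2 E2V.
rewrite iE1 /= in c1; rewrite jE2 orbT in c2.
case: (ltgtP (t l + s l * x B) (y B)) => lB.
- have sli : s i < s l.
    by apply: (slope_lt xBD (t2 := t i) (t1 := t l)); rewrite ?hiB ?hiD // ?ltW.
  have b1 : x B < x E1.
    rewrite ltNge; apply/negP => h.
    have := line_le_right (ltW sli) (etrans l1 (esym i1)) h.
    by rewrite hiB leNgt lB.
  have b2 : x E1 < x D.
    rewrite ltNge; apply/negP => h.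
    have := line_le_left (ltW sli) (etrans l1 (esym i1)) h.
    by rewrite hiD leNgt lD.
  by move: (c1 b1 isT) b2; rewrite leNgt => /negbTE ->.
- have slj : s l < s j.
    rewrite lt_neqAle; apply/andP; split.
      by apply: contra nlj => /eqP e; apply/eqP; apply: sI.
    by apply: (slope_le xBD (t2 := t l) (t1 := t j)); rewrite ?hjB ?(ltW lB).
  have b1 : x B < x E2.
    rewrite ltNge; apply/negP => h.
    have := line_le_right (ltW slj) (etrans j2 (esym l2)) h.
    by rewrite hjB leNgt lB.
  have b3 := c2 b1 isT.
  have b2 : x E2 <= x D.
    rewrite leNgt; apply/negP => h.
    have := line_lt_left slj (etrans j2 (esym l2)) h.
    by rewrite ltNge lj.
  have e : x E2 = x D by apply/eqP; rewrite eq_le b2 b3.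
  have := ljs; rewrite -e l2 j2 => /(_ erefl).
  by rewrite leNgt slj.
- have lB' : l \in B by rewrite bl // lA lB eqxx.
  have sli : s i < s l.
    by apply: (slope_lt xBD (t2 := t i) (t1 := t l)); rewrite ?hiB ?hiD ?lB.
  have slj : s l <= s j.
    by apply: (slope_le xBD (t2 := t l) (t1 := t j)); rewrite ?hjB ?lB.
  have : s l < s j.
    rewrite lt_neqAle slj andbT; apply: contra nlj => /eqP e.
    by apply/eqP; apply: sI.
  by move=> /(nbt l lB' sli).
Qed.

(* A wedge whose first boundary vertex [D] is on the lower side [i] is determined
   by [D]: the upper side [j] is the line just above [D], and the wedge starts at
   the last vertex of [j] before [D]. *)
Lemma corner_touch_inj (s t : I -> F) (y : {set I} -> F) (B B' D : {set I})
    (i j i' j' : I) :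
  blocks s t y -> {in A &, injective s} -> B \in V -> B' \in V -> D \in V ->
  corner s B i j -> x B < x D -> i \in D -> clear_until B i j (x D) ->
  corner s B' i' j' -> x B' < x D -> i' \in D -> clear_until B' i' j' (x D) ->
  [/\ B = B', i = i' & j = j'].
Proof.
move=> bl sI BV B'V DV c xBD iD clr c' xB'D i'D clr'.
have inA (E : {set I}) l : E \in V -> l \in E -> l \in A /\ t l + s l * x E = y E.
  by move=> EV; rewrite bl // => /andP[-> /eqP].
have above (E : {set I}) a b : E \in V -> corner s E a b -> x E < x D -> a \in D ->
    b \in A /\ y D < t b + s b * x D.
  move=> EV [aE bE sab _] xED aD.
  have [_ h1] := inA E a EV aE; have [bA h2] := inA E b EV bE.
  have [_ h3] := inA D a DV aD.
  split=> //; rewrite -h3.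
  by apply: (line_lt_right sab _ xED); rewrite h1 h2.
have [jA jD] := above B i j BV c xBD iD.
have [j'A j'D] := above B' i' j' B'V c' xB'D i'D.
(* [corner_unique] is applied to the wedge whose upper side is the higher one just left of [D], with
   the other upper side as [l]. *)
have ejj : j = j'.
  have k1 := corner_unique bl sI BV DV c xBD iD clr j'A j'D.
  have k2 := corner_unique bl sI B'V DV c' xB'D i'D clr' jA jD.
  case: (ltgtP (t j + s j * x D) (t j' + s j' * x D)) => h.
  - apply: k2; first exact: ltW. by move=> e; move: h; rewrite e ltxx.
  - symmetry; apply: k1; first exact: ltW. by move=> e; move: h; rewrite e ltxx.
  - case: (leP (s j) (s j')) => hs.
      by symmetry; apply: k1; rewrite ?h.
    by apply: k2; rewrite ?h // => _; apply: ltW.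
subst j'.
case: c c' => iB jB sij nbt [i'B' jB' si'j nbt'].
have exx : x B = x B'.
  apply/eqP; rewrite eq_le; apply/andP; split; rewrite leNgt; apply/negP => h.
    by have := clr' B BV h; rewrite jB orbT => /(_ isT); rewrite leNgt xBD.
  by have := clr B' B'V h; rewrite jB' orbT => /(_ isT); rewrite leNgt xB'D.
have eyy : y B = y B'.
  by have [_ <-] := inA B j BV jB; have [_ <-] := inA B' j B'V jB'; rewrite exx.
have eBB : B = B' by apply/setP => l; rewrite (bl B) // (bl B') // exx eyy.
subst B'; split=> //.
have [iA _] := inA B i BV iB; have [i'A _] := inA B i' BV i'B'.
apply: sI => //; apply/eqP; rewrite eq_le !leNgt; apply/andP; split; apply/negP => h.
  exact: (nbt' i).
exact: (nbt i').
Qed.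

(* Each [i] in a block [B] is sent to [B] itself if it has the largest slope in
   [B]. Otherwise it spans a wedge with its successor [j]; the wedge is sent to
   the first vertex to the right on [i] or on [j] or, if there is none, to the
   line [i]. *)
Lemma sum_blocks_le (s t : I -> F) (y : {set I} -> F) :
  blocks s t y -> {in A &, injective s} ->
  (\sum_(B in V) #|B| <= 3 * #|V| + #|A|)%N.
Proof.
move=> bl sI.
have inA (E : {set I}) l : E \in V -> l \in E -> l \in A /\ t l + s l * x E = y E.
  by move=> EV; rewrite bl // => /andP[-> /eqP].
pose E := [set e : {set I} * I | (e.1 \in V) && (e.2 \in e.1)].
have -> : (\sum_(B in V) #|B|)%N = #|E|.
  rewrite -sum1_card (eq_bigl (fun e : {set I} * I => (e.1 \in V) && (e.2 \in e.1)));
    last by move=> e; rewrite inE.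
  rewrite -(pair_big_dep (fun B => B \in V) (fun B i => i \in B) (fun _ _ => 1%N)) /=.
  by apply: eq_bigr => B _; rewrite sum1_card.
pose top (e : {set I} * I) D := D = e.1 /\ forall l, l \in e.1 -> s l <= s e.2.
pose up (e : {set I} * I) D := exists j, [/\ corner s e.1 e.2 j, x e.1 < x D,
  e.2 \in D & clear_until e.1 e.2 j (x D)].
pose down (e : {set I} * I) D := exists j, [/\ corner s e.1 e.2 j, x e.1 < x D,
  j \in D & clear_until e.1 e.2 j (x D)].
pose out (e : {set I} * I) i := i = e.2 /\ exists j, corner s e.1 e.2 j /\
  forall D : {set I}, D \in V -> (e.2 \in D) || (j \in D) -> x D <= x e.1.
pose sub (T : finType) (Y : {set T}) r :=
  [set e in E | `[< exists2 D, D \in Y & r e D >]].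
have subP (T : finType) (Y : {set T}) (r : {set I} * I -> T -> Prop) :
    (forall e e' D, e \in E -> e' \in E -> D \in Y -> r e D -> r e' D -> e = e') ->
    (#|sub _ Y r| <= #|Y|)%N.
  move=> rI; apply: (leq_card_rel (r := r)) => [e|e e' D].
    by rewrite inE => /andP[_ /asboolP].
  by rewrite !inE => /andP[eE _] /andP[e'E _]; apply: rI; rewrite inE.
have cov : E \subset sub _ V top :|: sub _ V up :|: sub _ V down :|: sub _ A out.
  apply/fintype.subsetP => -[B i] eE.
  have := eE; rewrite inE /= => /andP[BV iB].
  rewrite 3!finset.in_setU ![_ \in sub _ _ _]inE eE /=.
  case: (pickP (fun j => (j \in B) && (s i < s j))) => [j0 j0P|noj]; last first.
    do 3 (apply/orP; left). apply/asboolP; exists B => //; split=> //= l lB.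
    by have := noj l; rewrite lB /= leNgt => ->.
  case: (@Order.TotalTheory.arg_minP _ _ _ j0 (fun j => (j \in B) && (s i < s j)) s j0P)
    => j /andP[jB sij] jmin.
  have cij : corner s B i j.
    split=> // l lB sil slj; have := jmin l; rewrite lB sil => /(_ isT).
    by rewrite leNgt slj.
  case: (pickP (fun D : {set I} => [&& D \in V, x B < x D & (i \in D) || (j \in D)]))
    => [D0 D0P|noD]; last first.
    apply/orP; right; apply/asboolP; exists i; first by have [] := inA B i BV iB.
    split=> //; exists j; split=> // D DV ijD; have := noD D.
    by rewrite DV ijD andbT /= leNgt => ->.
  case: (@Order.TotalTheory.arg_minP _ _ _ D0 (fun D : {set I} =>
     [&& D \in V, x B < x D & (i \in D) || (j \in D)]) x D0P)
    => D /and3P[DV xBD ijD] Dmin.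
  have clr : clear_until B i j (x D).
    by move=> G GV xBG ijG; apply: Dmin; rewrite GV xBG ijG.
  apply/orP; left; case/orP: ijD => [iD|jD].
    apply/orP; left; apply/orP; right; apply/asboolP; exists D => //.
    by exists j.
  apply/orP; right; apply/asboolP; exists D => //; by exists j.
apply: leq_trans (subset_leq_card cov) _.
have le0 : (#|sub _ V top| <= #|V|)%N.
  apply: subP => -[B i] [B' i'] D; rewrite !inE /=.
  move=> /andP[BV iB] /andP[B'V i'B'] DV [/= -> h] [/= e h']; subst B'.
  congr (_, _); have [iA _] := inA B i BV iB; have [i'A _] := inA B i' BV i'B'.
  by apply: sI => //; apply/eqP; rewrite eq_le h // h'.
have le1 : (#|sub _ V up| <= #|V|)%N.
  apply: subP => -[B i] [B' i'] D; rewrite !inE /=.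
  move=> /andP[BV iB] /andP[B'V i'B'] DV [j /= [c1 c2 c3 c4]] [j' /= [d1 d2 d3 d4]].
  by have [-> -> _] := corner_touch_inj bl sI BV B'V DV c1 c2 c3 c4 d1 d2 d3 d4.
(* Reflection in the horizontal axis swaps the two sides of a wedge, which reduces this case to
   [corner_touch_inj]. *)
have le2 : (#|sub _ V down| <= #|V|)%N.
  have bl' : blocks (fun l => - s l) (fun l => - t l) (fun B => - y B).
    by move=> B l BV; rewrite bl // mulNr -opprD eqr_opp.
  have sI' : {in A &, injective (fun l => - s l)}.
    by move=> a b aA bA /= /oppr_inj; apply: sI.
  have cN B i j : corner s B i j -> corner (fun l => - s l) B j i.
    case=> iB jB sij nbt; split=> //; first by rewrite ltrN2.
    by move=> l lB; rewrite !ltrN2 => h1 h2; apply: (nbt l).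
  have clN B i j w : clear_until B i j w -> clear_until B j i w.
    by move=> h G GV xG; rewrite orbC; apply: h.
  apply: subP => -[B i] [B' i'] D; rewrite !inE /=.
  move=> /andP[BV iB] /andP[B'V i'B'] DV [j /= [c1 c2 c3 c4]] [j' /= [d1 d2 d3 d4]].
  by have [-> _ ->] := corner_touch_inj bl' sI' BV B'V DV (cN _ _ _ c1) c2 c3
    (clN _ _ _ _ c4) (cN _ _ _ d1) d2 d3 (clN _ _ _ _ d4).
(* Two such vertices lie on the same line and neither is to the right of the other, so they
   coincide. *)
have le3 : (#|sub _ A out| <= #|A|)%N.
  apply: subP => -[B i] [B' i'] k; rewrite !inE /=.
  move=> /andP[BV iB] /andP[B'V i'B'] kA [/= -> [j [c h]]] [/= e [j' [c' h']]].
  subst i'; have exx : x B = x B'.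
    by apply/eqP; rewrite eq_le h' ?iB //= h ?i'B'.
  have [_ e1] := inA B i BV iB; have [_ e2] := inA B' i B'V i'B'.
  have eyy : y B = y B' by rewrite -e1 -e2 exx.
  by congr (_, _); apply/setP => l; rewrite (bl B) // (bl B') // exx eyy.
rewrite mulSn mulSn mul1n !addnA.
apply: leq_trans (leq_card_setU _ _) (leq_add _ le3).
apply: leq_trans (leq_card_setU _ _) (leq_add _ le2).
exact: leq_trans (leq_card_setU _ _) (leq_add le0 le1).
Qed.
End Arrangement.

(** * Polynomial inequalities behind the two cases of the bound *)

Lemma cubic_le (n k x : int) : 1 <= k -> k <= x -> x <= 36 * k ^+ 2 ->
  108 * k ^+ 2 + 9 * k <= 2 * n ->
  k * (n - k) * (2 * n - 3 * k - 1) <= x * (n - x) * (2 * n - 3 * x - 1).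
Proof.
move=> k1 kx xk hn.
pose w := 2 * n - 108 * k ^+ 2 - 9 * k.
(* [h] is the difference of the two sides of the goal divided by [x - k]. *)
pose h := 3 * (x ^+ 2 + x * k + k ^+ 2) - (5 * n - 1) * (x + k) + n * (2 * n - 1).
have w0 : 0 <= w by rewrite /w; lia.
have k2 : k <= k ^+ 2 by rewrite expr2; nia.
(* The value of [2 * h] at [x = 36 k^2], expanded in the slack [w], plus the change from there to
   [x]. *)
have e1 : 2 * h = 6 * k ^+ 2 - 7 * k + w * (36 * k ^+ 2 + 13 * k - 1) + w ^+ 2 +
  2 * ((36 * k ^+ 2 - x) * (5 * n - 1 - 3 * (x + 36 * k ^+ 2) - 3 * k)).
  by rewrite /h /w; ring.
have p1 : 0 <= (36 * k ^+ 2 - x) * (5 * n - 1 - 3 * (x + 36 * k ^+ 2) - 3 * k).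
  by apply: mulr_ge0; lia.
have p2 : 0 <= 6 * k ^+ 2 - 7 * k + w * (36 * k ^+ 2 + 13 * k - 1).
  have [k3|k3] := leP 2 k.
    have : 0 <= w * (36 * k ^+ 2 + 13 * k - 1) by apply: mulr_ge0; lia.
    have : 2 * k <= k ^+ 2 by rewrite expr2; nia.
    lia.
  (* Here [6 k^2 - 7 k = -1], but [w = 2 n - 117] is odd, hence at least 1. *)
  have ek : k = 1 by lia.
  by move: w0; rewrite /w ek; lia.
have p3 : 0 <= w ^+ 2 by apply: sqr_ge0.
have h0 : 0 <= h by lia.
have h1 : 0 <= (x - k) * h by apply: mulr_ge0; lia.
rewrite -subr_ge0; move: h1; congr (is_true (_ <= _)); rewrite /h; ring.
Qed.

(** Here [x] and [r] count the points off and on a plane. The last hypothesis reads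
    [4 m >= 4 + x r (2 r - x - 1)], and [r = n - x] turns this into the cubic of [cubic_le]. *)
Lemma rich_plane_bound (n k x r m : nat) : (1 <= k)%N -> (k <= x)%N ->
  (x <= 36 * k ^ 2)%N -> (108 * k ^ 2 + 9 * k <= 2 * n)%N -> (x + r = n)%N ->
  (4 + 2 * x * (r * r.-1) <= 4 * m + x * x.-1 * r)%N ->
  (4 + k * (n - k) * (2 * n - 3 * k - 1) <= 4 * m)%N.
Proof.
move=> k1 kx xk hn xr hm.
have k2 : (k <= k ^ 2)%N by rewrite -mulnn; nia.
have e (a b : nat) : (b <= a)%N -> (a - b)%:Z = a%:Z - b%:Z by lia.
have r0 : (0 < r)%N by lia.
have hc := @cubic_le n k x.
have -> : (4 + k * (n - k) * (2 * n - 3 * k - 1) <= 4 * m)%N =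
  (4 + k%:Z * (n%:Z - k%:Z) * (2 * n%:Z - 3 * k%:Z - 1) <= 4 * m%:Z).
  rewrite -lez_nat !PoszD !PoszM !e ?PoszM //; lia.
apply: le_trans (lerD (lexx 4) (hc _ _ _ _)) _; [lia|lia| | |].
- by move: xk; rewrite -mulnn expr2; lia.
- by move: hn; rewrite -mulnn expr2; lia.
move: hm; rewrite -lez_nat !PoszD !PoszM -!subn1 !e //; last lia.
have -> : n%:Z = x%:Z + r%:Z by lia.
set X := x%:Z; set Y := r%:Z; set M := m%:Z.
have -> : (X + Y - X) = Y by ring.
move=> H.
rewrite -subr_ge0; rewrite -subr_ge0 in H; move: H.
congr (is_true (_ <= _)); ring.
Qed.

(** After multiplication of the goal by 12 both sides have leading term [24 k n^2], which is why the
    factor is [6 * k + 2]. What the hypothesis has in excess, mainly [n^2 + 60 k^2 n], absorbs the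
    lower terms. *)
Lemma spread_bound (n k m : nat) : (1 <= k)%N ->
  (108 * k ^ 2 + 9 * k <= 2 * n)%N ->
  (4 * (n * (n - 2) * (6 * k + 2)) <= 48 * m + 7 * (n * n.-1))%N ->
  (4 + k * (n - k) * (2 * n - 3 * k - 1) <= 4 * m)%N.
Proof.
move=> k1 hn hm.
have k2 : (k <= k ^ 2)%N by rewrite -mulnn; nia.
have e (a b : nat) : (b <= a)%N -> (a - b)%:Z = a%:Z - b%:Z by lia.
have -> : (4 + k * (n - k) * (2 * n - 3 * k - 1) <= 4 * m)%N =
  (4 + k%:Z * (n%:Z - k%:Z) * (2 * n%:Z - 3 * k%:Z - 1) <= 4 * m%:Z).
  rewrite -lez_nat !PoszD !PoszM !e ?PoszM //; lia.
move: hm; rewrite -lez_nat -subn1 !PoszD !PoszM !e //; [|lia|lia].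
rewrite PoszD PoszM.
have : 54 * (k%:Z * k%:Z) <= n%:Z by move: hn; rewrite -mulnn; lia.
have : 1 <= k%:Z by lia.
have : 59 <= n%:Z by lia.
set K := k%:Z; set N := n%:Z; set M := m%:Z => N0 K1 NK H.
have p1 : 0 <= N * (N - 59) by apply: mulr_ge0; lia.
have p2 : 0 <= (K * N) * (K - 1) by apply: mulr_ge0; [apply: mulr_ge0; lia|lia].
have p3 : 0 <= (N - 54 * (K * K)) * K by apply: mulr_ge0; lia.
have p4 : K <= K * K by nia.
have p5 : 0 <= (K - 1) * N by apply: mulr_ge0; lia.
nia.
Qed.

(** * Incidences of abstract planes on a finite set of points *)

Section Incidences.
Local Open Scope nat_scope.

Section DoubleCounting.
Variables (T : finType) (Q : {set {set T}}) (A : {set T}).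

Lemma sum_through (f : {set T} -> nat) :
  \sum_(q in A) \sum_(P in Q | q \in P) f P = \sum_(P in Q) #|P :&: A| * f P.
Proof.
rewrite (exchange_big_dep (fun P => P \in Q)) /=; last by move=> q P _ /andP[].
apply: eq_bigr => P PQ; rewrite -sum_nat_const; apply: eq_bigl => q.
by rewrite inE PQ /= andbC.
Qed.

Lemma sum_card_through : \sum_(q in A) #|[set P in Q | q \in P]| = \sum_(P in Q) #|P :&: A|.
Proof.
under [RHS]eq_bigr do rewrite -[#|_|]muln1.
rewrite -sum_through; apply: eq_bigr => q _.
by rewrite -sum1_card; apply: eq_bigl => P; rewrite inE.
Qed.
End DoubleCounting.

Lemma sum_card_through2 (T : finType) (Q : {set {set T}}) (A : {set T}) :
  \sum_(q in A) \sum_(q' in A :\ q) #|[set P in Q | (q \in P) && (q' \in P)]| =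
  \sum_(P in Q) #|P :&: A| * (#|P :&: A|).-1.
Proof.
rewrite -sum_through; apply: eq_bigr => q qA.
rewrite (eq_bigr (fun q' => #|[set P in [set P in Q | q \in P] | q' \in P]|)); last first.
  by move=> q' _; apply: eq_card => P; rewrite !inE andbA.
rewrite sum_card_through; apply: eq_big => P; first by rewrite inE.
rewrite inE => /andP[_ qP].
have -> : P :&: (A :\ q) = (P :&: A) :\ q by apply/setP => z; rewrite !inE andbCA.
by rewrite [in RHS](cardsD1 q) inE qP qA.
Qed.

Section Planes.
Variables (T : finType) (PP : {set {set T}}).
Hypothesis card_ge3 : forall P, P \in PP -> 2 < #|P|.
Hypothesis plane_through : forall a b c, a != b -> a != c -> b != c ->
  exists P, [/\ P \in PP, a \in P, b \in P & c \in P].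
Hypothesis plane_unique : forall P P' a b c, P \in PP -> P' \in PP ->
  a != b -> a != c -> b != c -> a \in P -> b \in P -> c \in P ->
  a \in P' -> b \in P' -> c \in P' -> P = P'.

Lemma card_meet_le2 (P P' : {set T}) : P \in PP -> P' \in PP -> P != P' -> #|P :&: P'| <= 2.
Proof.
move=> PV PV' /eqP nPP; rewrite leqNgt; apply/negP => /card_gt2P [a [b [c []]]].
rewrite !inE => -[/andP[a1 a2] /andP[b1 b2] /andP[c1 c2]] [ab bc ca].
by apply: nPP; apply: (plane_unique (a := a) (b := b) (c := c)); rewrite // eq_sym.
Qed.

(* Planes meeting [P0] in two points, counted by their points off [P0]:
   a plane with [c] such points satisfies [1 >= c - 'C(c, 2)]. *)
Lemma planes_off_plane (P0 : {set T}) : P0 \in PP ->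
  4 + 2 * #|~: P0| * (#|P0| * #|P0|.-1) <= 4 * #|PP| + #|~: P0| * #|~: P0|.-1 * #|P0|.
Proof.
move=> P0P; set r := #|P0|; set x := #|~: P0|.
pose Q := [set P in PP | #|P :&: P0| == 2].
have QP P : P \in Q -> P \in PP /\ #|P :&: P0| = 2 by rewrite inE => /andP[-> /eqP].
have off P : P \in Q -> 0 < #|P :&: ~: P0|.
  move=> /QP [/card_ge3]; rewrite -(cardsID P0 P) finset.setDE => h e.
  by rewrite e in h; lia.
(* [P0] itself is not in [Q]; it accounts for the summand 4. *)
have cardQ : #|Q| < #|PP|.
  apply: proper_card; apply/properP; split.
    by apply/fintype.subsetP => P /QP [].
  exists P0 => //; rewrite inE P0P finset.setIid /=.
  by have := card_ge3 P0P; case: ltngtP.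
(* Each pair of points of [P0] spans with [q] a plane that meets [P0] in this pair only. *)
have through q : q \in ~: P0 -> r * r.-1 <= 2 * #|[set P in Q | q \in P]|.
  rewrite inE => qP0; set Qq := [set P in Q | q \in P].
  have := sum_card_through2 Qq P0.
  rewrite [RHS](eq_bigr (fun=> 2)); last first.
    by move=> P; rewrite inE => /andP[/QP [_ ->]].
  rewrite sum_nat_const mulnC => <-.
  have -> : r * r.-1 = \sum_(a in P0) \sum_(b in P0 :\ a) 1.
    rewrite -sum_nat_const; apply: eq_bigr => a aP0.
    by rewrite sum1_card /r (cardsD1 a) aP0.
  apply: leq_sum => a aP0; apply: leq_sum => b; rewrite !inE => /andP[ba bP0].
  have qa : q != a by apply: contraNneq qP0 => ->.
  have qb : q != b by apply: contraNneq qP0 => ->.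
  have ab : a != b by rewrite eq_sym.
  have [P [PP' qP aP bP]] := plane_through qa qb ab.
  apply/card_gt0P; exists P; rewrite !inE PP' qP aP bP /= andbT.
  rewrite eqn_leq card_meet_le2 ?andTb ?andbT //=; last by apply: contraNneq qP0 => <-.
  rewrite ?andbT; apply: (@leq_trans #|[set a; b]|); first by rewrite cards2 ab.
  apply: subset_leq_card; apply/fintype.subsetP => z; rewrite !inE.
  by case/orP => /eqP ->; apply/andP.
(* A point of [P0] lies on at most one plane through [q] and [q'], so the planes counted here use
   disjoint pairs of [P0]. *)
have through2 q q' : q \in ~: P0 -> q' \in ~: P0 :\ q ->
    2 * #|[set P in Q | (q \in P) && (q' \in P)]| <= r.
  rewrite !inE => qP0 /andP[qq' q'P0].
  set Qq := [set P in Q | _].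
  have := sum_card_through Qq P0.
  rewrite [RHS](eq_bigr (fun=> 2)); last first.
    by move=> P; rewrite inE => /andP[/QP [_ ->]].
  rewrite sum_nat_const mulnC => <-.
  rewrite /r -sum1_card; apply: leq_sum => a aP0.
  rewrite leqNgt; apply/negP => /card_gt1P [P [P' [h h' /eqP]]]; apply.
  move: h h'; rewrite !inE -!andbA => /and5P[PV _ qP q'P aP] /and5P[PV' _ qP' q'P' aP'].
  apply: (plane_unique (a := a) (b := q) (c := q')) => //.
  - by apply: contraNneq qP0 => <-.
  - by apply: contraNneq q'P0 => <-.
  - by rewrite eq_sym.
have s1 : x * (r * r.-1) <= 2 * \sum_(P in Q) #|P :&: ~: P0|.
  rewrite -sum_card_through /x -sum_nat_const big_distrr /=.
  by apply: leq_sum => q qx; apply: through.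
have s2 : 2 * \sum_(P in Q) #|P :&: ~: P0| * #|P :&: ~: P0|.-1 <= x * x.-1 * r.
  rewrite -sum_card_through2 -mulnA /x -sum_nat_const big_distrr /=.
  apply: leq_sum => q qx.
  have -> : #|~: P0|.-1 = #|~: P0 :\ q| by rewrite [in LHS](cardsD1 q) qx.
  rewrite -sum_nat_const big_distrr /=.
  by apply: leq_sum => q' q'x; apply: through2.
have s3 : 2 * \sum_(P in Q) #|P :&: ~: P0| <=
    2 * #|Q| + \sum_(P in Q) #|P :&: ~: P0| * #|P :&: ~: P0|.-1.
  rewrite mulnC -sum1_card !big_distrl big_distrr /= -big_split /=.
  apply: leq_sum => P PQ; have := off P PQ.
  by case: #|P :&: ~: P0| => [//|[|[|c]]] //= _; nia.
set s := \sum_(P in Q) #|P :&: ~: P0| in s1 s3.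
set s' := \sum_(P in Q) _ in s2 s3.
lia.
Qed.

Definition pair_degree (p q : T) := #|[set P in PP | (p \in P) && (q \in P)]|.

(* A point off [P0] is determined by the plane joining it to [p], [q] and the
   plane joining it to [p], [q']. *)
Lemma rich_plane_of_low_pairs (p q q' : T) (e : nat) :
  p != q -> p != q' -> q != q' ->
  pair_degree p q <= e.+1 -> pair_degree p q' <= e.+1 ->
  exists2 P0, P0 \in PP & #|~: P0| <= e * e.
Proof.
move=> pq pq' qq' dq dq'.
have [P0 [P0P pP0 qP0 q'P0]] := plane_through pq pq' qq'; exists P0 => //.
(* No point off [P0] uses [P0]; discarding it lowers the bound from [e.+1] to [e]. *)
pose D u := [set P in PP | (p \in P) && (u \in P)] :\ P0.
have cD u : u \in P0 -> pair_degree p u <= e.+1 -> #|D u| <= e.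
  by move=> uP0; rewrite /pair_degree (cardsD1 P0) inE P0P pP0 uP0.
apply: leq_trans (leq_mul (cD q qP0 dq) (cD q' q'P0 dq')).
rewrite -cardsX.
pose r z (w : {set T} * {set T}) := z \in w.1 /\ z \in w.2.
apply: (leq_card_rel (r := r)) => [z|z z' [P1 P2]].
  rewrite inE => zP0.
  have zn u : u \in P0 -> u != z by move=> uP0; apply: contraNneq zP0 => <-.
  have ex u : u \in P0 -> p != u -> exists2 P, P \in D u & z \in P.
    move=> uP0 pu; have [P [PV pP uP zP]] := plane_through pu (zn p pP0) (zn u uP0).
    exists P => //; rewrite !inE PV pP uP !andbT.
    by apply: contraNneq zP0 => <-.
  have [P1 P1D z1] := ex q qP0 pq; have [P2 P2D z2] := ex q' q'P0 pq'.
  by exists (P1, P2); rewrite // inE /= P1D P2D.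
rewrite !inE /= => zP0 z'P0 /andP[/and4P[nP1 PV1 p1 q1] /and4P[_ PV2 p2 q'2]].
move=> [/= z1 z2] [/= z'1 z'2]; apply/eqP; apply: contraT => zz'.
have pz : p != z by apply: contraNneq zP0 => <-.
have pz' : p != z' by apply: contraNneq z'P0 => <-.
have eP := plane_unique PV1 PV2 pz pz' zz' p1 z1 z'1 p2 z2 z'2; subst P2.
by rewrite (plane_unique P0P PV1 pq pq' qq' pP0 qP0 q'P0 p1 q1 q'2) eqxx in nP1.
Qed.

Lemma card_planes_ge (k : nat) : 1 <= k -> 108 * k ^ 2 + 9 * k <= 2 * #|T| ->
  (forall P, P \in PP -> #|P| <= #|T| - k) ->
  (forall p, \sum_(P in PP | p \in P) #|P| <=
     4 * #|[set P in PP | p \in P]| + #|T|.-1) ->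
  4 + k * (#|T| - k) * (2 * #|T| - 3 * k - 1) <= 4 * #|PP|.
Proof.
move=> k1 hn hmax mel; set n := #|T| in hn hmax mel *.
case: (pickP (fun w : T * T * T => [&& w.1.1 != w.1.2, w.1.1 != w.2, w.1.2 != w.2,
    pair_degree w.1.1 w.1.2 <= (6 * k).+1 & pair_degree w.1.1 w.2 <= (6 * k).+1])).
  move=> [[p q] q'] /= /and5P[pq pq' qq' dq dq'].
  have [P0 P0P x0] := rich_plane_of_low_pairs pq pq' qq' dq dq'.
  have xr := cardsC P0; have rk := hmax _ P0P.
  have k2 : k <= k ^ 2 by rewrite -mulnn; nia.
  apply: (rich_plane_bound k1 (x := #|~: P0|) (r := #|P0|)) => //.
  - by rewrite -/n in xr; lia.
  - by rewrite -mulnn; lia.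
  - by rewrite addnC.
  - exact: planes_off_plane.
move=> nolow; apply: spread_bound => //; rewrite -/n.
(* By [nolow] at most one [q] has low degree; each of the other [n - 2] or more contributes at least
   [6 * k + 2]. *)
have low p : (n - 2) * (6 * k + 2) <= \sum_(q in [set: T] :\ p) pair_degree p q.
  pose L := [set q in [set: T] :\ p | pair_degree p q <= (6 * k).+1].
  have L1 : #|L| <= 1.
    rewrite leqNgt; apply/negP => /card_gt1P [q [q' [qL q'L qq']]].
    move: qL q'L; rewrite !inE !andbT => /andP[qp dq] /andP[q'p dq'].
    by have := nolow (p, q, q'); rewrite /= qq' dq dq' eq_sym qp eq_sym q'p.
  rewrite (big_setID L) /=; apply: leq_trans (leq_addl _ _).
  apply: (@leq_trans (#|([set: T] :\ p) :\: L| * (6 * k + 2))).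
    rewrite leq_mul2r; apply/orP; right.
    have := cardsD1 p [set: T]; rewrite inE cardsT -/n.
    have := cardsID L ([set: T] :\ p).
    have : #|([set: T] :\ p) :&: L| <= #|L|.
      by apply: subset_leq_card; apply: subsetIr.
    lia.
  rewrite -sum_nat_const; apply: leq_sum => q; rewrite !inE !andbT.
  by rewrite negb_and => /andP[/orP[/negP//|]]; rewrite -ltnNge; lia.
have s1 : n * ((n - 2) * (6 * k + 2)) <= \sum_(P in PP) #|P| * #|P|.-1.
  rewrite [X in _ <= X](eq_bigr (fun P => #|P :&: [set: T]| * #|P :&: [set: T]|.-1));
    last by move=> P _; rewrite finset.setIT.
  rewrite -sum_card_through2 {1}/n -cardsT -sum_nat_const.
  by apply: leq_sum => p _; apply: low.
have s2 : \sum_(P in PP) #|P| * #|P| <= 4 * (\sum_(P in PP) #|P|) + n * n.-1.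
  have h f : \sum_(p in [set: T]) \sum_(P in PP | p \in P) f P = \sum_(P in PP) #|P| * f P.
    by rewrite sum_through; apply: eq_bigr => P _; rewrite finset.setIT.
  have h' : \sum_(p in [set: T]) #|[set P in PP | p \in P]| = \sum_(P in PP) #|P|.
    by rewrite sum_card_through; apply: eq_bigr => P _; rewrite finset.setIT.
  rewrite -h -h' big_distrr /= {1}/n -cardsT -sum_nat_const -big_split /=.
  by apply: leq_sum => p _; apply: mel.
(* For each plane the two sides differ by [3 (#|P| - 4)^2]; adding 7 times [s2] then cancels the
   terms with 28. *)
have s3 : 4 * (\sum_(P in PP) #|P| * #|P|.-1) + 28 * (\sum_(P in PP) #|P|) <=
    48 * #|PP| + 7 * (\sum_(P in PP) #|P| * #|P|).
  rewrite -[#|PP|]sum1_card !big_distrr /= -!big_split /=.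
  apply: leq_sum => P _.
  (* [(#|P| - 4) ^ 2 >= 0] *)
  case: #|P| => [//|i] /=.
  case: (leqP i 3) => [|]; nia.
rewrite -mulnA; lia.
Qed.
End Planes.

End Incidences.

(** * Generic coordinates, projection from a point and duality *)

Lemma exists_nonroot (F : numFieldType) (p : {poly F}) : p != 0 -> exists t, p.[t] != 0.
Proof.
move=> p0; case: (boolP (all (root p) [seq i%:R | i <- iota 0 (size p)])) => [h|].
  have hu : uniq [seq i%:R : F | i <- iota 0 (size p)].
    by rewrite map_inj_uniq ?iota_uniq // => i j /eqP; rewrite eqr_nat => /eqP.
  by have := max_poly_roots p0 h hu; rewrite size_map size_iota ltnn.
by move=> /allPn [t _]; rewrite /root => h; exists t.
Qed.

Section Coordinates.
Variables (R : realFieldType) (t : R).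
Implicit Types u v w x : 'rV[R]_3.

(* A unimodular change of coordinates; for all but finitely many [t] the first
   two coordinates keep finitely many given planar conditions nondegenerate. *)
Definition ca u := u 0 0 + t ^+ 3 * u 0 2.
Definition cb u := t * u 0 0 + u 0 1 + t ^+ 2 * u 0 2.
Definition cc u := u 0 2.
Definition minor u v := ca u * cb v - ca v * cb u.
(** The determinant of [u], [v], [x] in the new coordinates, expanded along [cc]. *)
Definition volume u v x := cc x * minor u v - cc v * minor u x + cc u * minor v x.

Lemma row3_eq u v : u 0 0 = v 0 0 -> u 0 1 = v 0 1 -> u 0 2 = v 0 2 -> u = v.
Proof.
move=> e0 e1 e2; apply/rowP => -[[|[|[|i]]] hi] //.
- by rewrite (_ : Ordinal hi = 0) //; apply: val_inj.
- by rewrite (_ : Ordinal hi = 1) //; apply: val_inj.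
- by rewrite (_ : Ordinal hi = 2) //; apply: val_inj.
Qed.

Lemma coords_eq u v : ca u = ca v -> cb u = cb v -> cc u = cc v -> u = v.
Proof.
rewrite /ca /cb /cc => e0 e1 e2; rewrite e2 in e0 e1.
have e0' := addIr _ e0; rewrite e0' in e1.
by apply: row3_eq => //; have := addIr _ e1; exact: addrI.
Qed.

(** Cramer's rule in the first two coordinates fixes the coefficients; the third coordinate then
    agrees exactly when the determinant vanishes. *)
Lemma mem_span2 u v x : minor u v != 0 ->
  (x \in <<[:: u; v]>>%VS) = (volume u v x == 0).
Proof.
move=> m0; rewrite span_cons span_seq1; apply/idP/eqP.
  move=> /memv_addP [_ /vlineP [k ->] [_ /vlineP [l ->] ->]].
  by rewrite /volume /minor /ca /cb /cc !mxE; ring.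
rewrite /volume => /eqP; rewrite addrAC addr_eq0 => h.
suff -> : x = (minor x v / minor u v) *: u + (minor u x / minor u v) *: v.
  by apply: memv_add; apply: rpredZ; apply: memv_line.
have ec : cc x = (minor x v * cc u + minor u x * cc v) / minor u v.
  apply: (mulIf m0); rewrite divfK //; move: h; rewrite -addr_eq0 => /eqP h.
  apply/eqP; rewrite -subr_eq0 -h; apply/eqP; rewrite /minor; ring.
apply: coords_eq.
- by apply: (mulIf m0); move: m0; rewrite /minor /ca /cb !mxE => m0; field.
- by apply: (mulIf m0); move: m0; rewrite /minor /ca /cb !mxE => m0; field.
- by rewrite ec /cc !mxE; field.
Qed.

Lemma dim_span2 u v : minor u v != 0 -> \dim <<[:: u; v]>> = 2%N.
Proof.
move=> m0; apply/eqP; rewrite -/(size [:: u; v]) -/(free _) free_cons span_seq1.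
apply/andP; split.
  apply: contra m0 => /vlineP [k ->].
  by rewrite /minor /ca /cb !mxE; apply/eqP; ring.
rewrite seq1_free; apply: contra m0 => /eqP ->.
by rewrite /minor /ca /cb !mxE; apply/eqP; ring.
Qed.

End Coordinates.

(** Each condition is the nonvanishing at [t] of a nonzero polynomial, so a nonroot of the product
    serves all points at once. The conditions on [cb] will make the dual slopes finite, those on
    [minor] will make them distinct. *)
Lemma exists_generic (R : realFieldType) (T : finType) (f : T -> 'rV[R]_3) :
  injective f ->
  (forall p q r, p != q -> p != r -> q != r ->
     exists t, minor t (f q - f p) (f r - f p) != 0) ->
  exists t, (forall p q, p != q -> cb t (f q - f p) != 0) /\
    forall p q r, p != q -> p != r -> q != r -> minor t (f q - f p) (f r - f p) != 0.
Proof.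
move=> fI hM.
pose pb (u : 'rV[R]_3) : {poly R} := Poly [:: u 0 1; u 0 0; u 0 2].
pose pm (u v : 'rV[R]_3) : {poly R} :=
  let w0 := u 0 1 * v 0 2 - u 0 2 * v 0 1 in
  let w1 := u 0 2 * v 0 0 - u 0 0 * v 0 2 in
  Poly [:: u 0 0 * v 0 1 - u 0 1 * v 0 0; 0; - w1; - w0; w1].
have pbE u s : (pb u).[s] = cb s u by rewrite horner_Poly /= /cb; ring.
have pmE u v s : (pm u v).[s] = minor s u v.
  by rewrite horner_Poly /= /minor /ca /cb; ring.
have pb0 u : u != 0 -> pb u != 0.
  apply: contra => /eqP e; have h i : (pb u)`_i = 0 by rewrite e coef0.
  have := h 0%N; have := h 1%N; have := h 2%N; rewrite !coef_Poly /= => h2 h1 h0.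
  by apply/eqP; apply: row3_eq; rewrite !mxE.
pose P1 := \prod_(e : T * T | e.1 != e.2) pb (f e.2 - f e.1).
pose P2 := \prod_(e : T * T * T | [&& e.1.1 != e.1.2, e.1.1 != e.2 & e.1.2 != e.2])
  pm (f e.1.2 - f e.1.1) (f e.2 - f e.1.1).
have P1n : P1 != 0.
  apply/prodf_neq0 => -[p q] /= pq; apply: pb0; rewrite subr_eq0.
  by apply: contra pq => /eqP /fI ->.
have P2n : P2 != 0.
  apply/prodf_neq0 => -[[p q] r] /= /and3P[pq pr qr].
  have [s hs] := hM p q r pq pr qr.
  by apply: contraNneq hs => e; rewrite -pmE e horner0.
have [s] := exists_nonroot (mulf_neq0 P1n P2n).
rewrite hornerM mulf_eq0 negb_or !horner_prod => /andP[/prodf_neq0 h1 /prodf_neq0 h2].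
exists s; split=> [p q pq|p q r pq pr qr].
  by rewrite -pbE; apply: (h1 (p, q)).
by rewrite -pmE; apply: (h2 (p, q, r)); rewrite /= pq pr qr.
Qed.

(** Relative to [f p], a plane [cc + X ca = Y cb] is dual to the point ([X], [Y]). Division by [cb]
    turns each other point [l] into a line of slope [s l] and intercept [c l], which passes through
    that dual point exactly when [l] is on the plane. *)
Lemma sum_planes_through_le (R : realFieldType) (T : finType) (f : T -> 'rV[R]_3)
    (t : R) (PP : {set {set T}}) :
  (forall p q, p != q -> cb t (f q - f p) != 0) ->
  (forall p q r, p != q -> p != r -> q != r -> minor t (f q - f p) (f r - f p) != 0) ->
  (forall P, P \in PP -> (2 < #|P|)%N) ->
  (forall a b c, a != b -> a != c -> b != c ->
     exists P : {set T}, [/\ P \in PP, a \in P, b \in P & c \in P]) ->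
  (forall P a b c l, P \in PP -> a != b -> a != c -> b != c -> a \in P -> b \in P ->
     c \in P -> (l \in P) = (volume t (f b - f a) (f c - f a) (f l - f a) == 0)) ->
  forall p, (\sum_(P in PP | p \in P) #|P| <=
     4 * #|[set P in PP | p \in P]| + #|T|.-1)%N.
Proof.
move=> hb hm card_ge3 through mem p.
pose A := [set: T] :\ p; pose Q := [set P in PP | p \in P].
pose V := [set P :\ p | P in Q].
have QI : {in Q &, injective (fun P => P :\ p)}.
  move=> P P'; rewrite !inE => /andP[_ pP] /andP[_ pP'] e.
  by rewrite -(finset.setD1K pP) e finset.setD1K.
pose s l := ca t (f l - f p) / cb t (f l - f p).
pose c l := cc (f l - f p) / cb t (f l - f p).
have [xy xyP] : {xy : {set T} -> R * R & forall B, B \in V ->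
    forall l, (l \in B) = (l \in A) && (c l + s l * (xy B).1 == (xy B).2)}.
  apply: (@boolp.choice _ _ (fun B w => B \in V -> forall l,
    (l \in B) = (l \in A) && (c l + s l * w.1 == w.2))) => B.
  case: (boolP (B \in V)) => [|_]; last by exists (0, 0).
  move=> /imsetP [P]; rewrite inE => /andP[PP' pP] ->.
  have : (1 < #|P :\ p|)%N by have := card_ge3 _ PP'; rewrite (cardsD1 p) pP; lia.
  move=> /card_gt1P [q [r []]]; rewrite !inE => /andP[qp qP] /andP[rp rP] qr.
  have pq : p != q by rewrite eq_sym.
  have pr : p != r by rewrite eq_sym.
  pose u : 'rV[R]_3 := f q - f p; pose v : 'rV[R]_3 := f r - f p; pose m := minor t u v.
  have m0 : m != 0 by apply: hm.
  (* Cramer's solution ([X], [Y]) of the two plane equations for [u] and [v]. *)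
  exists ((cc v * cb t u - cc u * cb t v) / m, (cc v * ca t u - cc u * ca t v) / m) => _ l.
  rewrite !inE andbT; case: (altP (l =P p)) => //= lp.
  rewrite (mem P p q r l PP' pq pr qr pP qP rP) -/u -/v -[RHS]subr_eq0.
  have b0 : cb t (f l - f p) != 0 by apply: hb; rewrite eq_sym.
  rewrite /c /s /=; set w : 'rV[R]_3 := f l - f p in b0 *.
  have -> : cc w / cb t w + ca t w / cb t w * ((cc v * cb t u - cc u * cb t v) / m) -
    (cc v * ca t u - cc u * ca t v) / m = volume t u v w / (m * cb t w).
    rewrite /volume -/m /minor; field; exact/andP.
  by rewrite mulf_eq0 invr_eq0 mulf_eq0 (negbTE m0) (negbTE b0) !orbF.
have cover i j : i \in A -> j \in A -> i != j ->
    exists B : {set T}, [/\ B \in V, i \in B & j \in B].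
  rewrite !inE !andbT => ip jp ij.
  have pi : p != i by rewrite eq_sym.
  have pj : p != j by rewrite eq_sym.
  have [P [PP' pP iP jP]] := through p i j pi pj ij; exists (P :\ p).
  by rewrite !inE ip jp; split=> //; apply: imset_f; rewrite inE PP'.
have bl : blocks A V (fun B => (xy B).1) s c (fun B => (xy B).2).
  by move=> B l BV; apply: xyP.
have sI : {in A &, injective s}.
  move=> i j; rewrite !inE !andbT => ip jp e; apply/eqP; apply: contraT => ij.
  have pi : p != i by rewrite eq_sym.
  have pj : p != j by rewrite eq_sym.
  have := hm p i j pi pj ij; rewrite /minor subr_eq0 -eqr_div ?hb //.
  by rewrite -/(s i) -/(s j) e eqxx.
have := sum_blocks_le cover bl sI.
rewrite (card_in_imset QI) big_imset //=.
have -> : #|A| = #|T|.-1.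
  by have := cardsD1 p [set: T]; rewrite inE cardsT /A; lia.
(* Putting [p] back adds 1 per plane, which turns the coefficient 3 of [sum_blocks_le] into 4. *)
have -> : (\sum_(P in PP | p \in P) #|P| = \sum_(P in Q) #|P :\ p| + #|Q|)%N.
  rewrite -[X in (_ + X)%N]sum1_card -big_split /=.
  apply: eq_big => P; first by rewrite inE.
  by case/andP => _ pP; rewrite (cardsD1 p) pP addnC.
by rewrite -/Q -(leq_add2r #|Q|) [(4 * _)%N]mulSnr addnAC.
Qed.

(** * Planes and collinearity in terms of [volume] and [minor] *)

Lemma plane_span (R : realType) (t : R) (P : set 'rV[R]_3) (p q r : 'rV[R]_3) :
  is_plane P -> P p -> P q -> P r -> minor t (q - p) (r - p) != 0 ->
  forall z, P z <-> volume t (q - p) (r - p) (z - p) = 0.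
Proof.
move=> [o [U [dU ->]]] /= po qo ro m0 z.
have sub w : w - o \in U -> w - p \in U.
  move=> wo; have -> : w - p = (w - o) - (p - o) by rewrite opprB addrA subrK.
  exact: rpredB.
have eU : <<[:: q - p; r - p]>>%VS = U.
  apply/eqP; rewrite eqEdim (dim_span2 m0) dU leqnn andbT.
  by apply/span_subvP => w; rewrite !inE => /orP[/eqP ->|/eqP ->]; apply: sub.
rewrite (rwP eqP) -(mem_span2 _ m0) eU; split; first exact: sub.
move=> h; have -> : z - o = (z - p) + (p - o) by rewrite addrA subrK.
exact: rpredD.
Qed.

Lemma is_plane_span (R : realType) (t : R) (p u v : 'rV[R]_3) :
  minor t u v != 0 -> is_plane [set z | z - p \in <<[:: u; v]>>%VS]%classic.
Proof. by move=> m0; exists p, <<[:: u; v]>>%VS; rewrite (dim_span2 m0). Qed.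

(** The coefficients of [minor] in [t] are, up to sign, the components of the cross product. If it
    vanished at 0, 1 and 2, the cross product would be zero and the two vectors parallel. *)
Lemma exists_minor (R : realType) (p q r : 'rV[R]_3) :
  p != q -> ~ collinear p q r -> exists t, minor t (q - p) (r - p) != 0.
Proof.
move=> pq ncol; apply: contrapT => /boolp.forallNP h; apply: ncol.
have m t : minor t (q - p) (r - p) = 0 by apply/eqP; apply: contrapT => /negP /h.
suff vu : r - p \in <[q - p]>%VS.
  exists [set z | z - p \in <[q - p]>%VS]%classic; split => //=.
  - by exists p, <[q - p]>%VS; rewrite dim_vline subr_eq0 eq_sym pq.
  - by rewrite subrr mem0v.
  - exact: memv_line.
have : q - p != 0 by rewrite subr_eq0 eq_sym.
move: (q - p) (r - p) m => u v m u0.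
pose w0 := u 0 1 * v 0 2 - u 0 2 * v 0 1.
pose w1 := u 0 2 * v 0 0 - u 0 0 * v 0 2.
pose w2 := u 0 0 * v 0 1 - u 0 1 * v 0 0.
have mE t : w2 - w1 * t ^+ 2 - w0 * t ^+ 3 + w1 * t ^+ 4 = 0.
  by rewrite -(m t) /minor /ca /cb /w0 /w1 /w2; ring.
have e2 : w2 = 0 by have := mE 0; rewrite !expr0n /=; lra.
have e0 : w0 = 0 by have := mE 1; rewrite !expr1n; lra.
have e1 : w1 = 0 by have := mE 2; rewrite e2 e0; lra.
have par k : u 0 k != 0 -> v 0 0 * u 0 k = v 0 k * u 0 0 ->
    v 0 1 * u 0 k = v 0 k * u 0 1 -> v 0 2 * u 0 k = v 0 k * u 0 2 -> v \in <[u]>%VS.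
  move=> uk h0 h1 h2; apply/vlineP; exists (v 0 k / u 0 k).
  by apply: row3_eq; apply: (mulIf uk); rewrite !mxE mulrAC divfK.
rewrite /w0 /w1 /w2 in e0 e1 e2.
have [u00|k0] := eqVneq (u 0 0) 0; last by apply: (par 0) => //; lra.
have [u01|k1] := eqVneq (u 0 1) 0; last by apply: (par 1) => //; lra.
have [u02|k2] := eqVneq (u 0 2) 0; last by apply: (par 2) => //; lra.
by case/eqP: u0; apply: row3_eq; rewrite mxE.
Qed.

Lemma bin2R (R : realFieldType) (a : nat) : 'C(a, 2)%:R = a%:R * (a%:R - 1) / 2 :> R.
Proof.
have h : ('C(a, 2) * 2 = a * a.-1)%N by have := bin_ffact a 2; rewrite !ffactnS ffactn0 muln1.
have h' : 'C(a, 2)%:R * 2 = a%:R * a.-1%:R :> R by rewrite -!natrM h.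
case: a h' {h} => [|a] /=; first by rewrite bin0n !mul0r.
have -> : a.+1%:R - 1 = a%:R :> R by rewrite -natr1 addrK.
by move=> <-; rewrite mulfK // pnatr_eq0.
Qed.

(** * From determined planes to their traces on the point set *)

Theorem theorem4 (R : realType) (n k : nat) (S : {fset 'rV[R]_3})
  (hk : (1 <= k)%N)
  (hS : #|` S|%fset = n)
  (hcol : no_three_collinear S)
  (hplane : forall P : set 'rV[R]_3, is_plane P ->
     (#|` points_on S P|%fset <= n - k)%N)
  (hn : 54 * k%:R ^+ 2 + 9 / 2 * k%:R <= n%:R :> R) :
  1 + k%:R * 'C(n - k, 2)%:R - 'C(k, 2)%:R * ((n%:R - k%:R) / 2)
    <= (num_determined_planes S)%:R :> R.
Proof.
have hn' : (108 * k ^ 2 + 9 * k <= 2 * n)%N.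
  rewrite -(ler_nat R) -mulnn natrD !natrM; lra.
have k2 : (k <= k ^ 2)%N by rewrite -mulnn; nia.
have kn : (k <= n)%N by lia.
(* A plane is replaced by its set of points in [S], to which the incidence counts apply. *)
pose trace (P : set 'rV[R]_3) : {set S} := [set z : S | val z \in P].
pose PP : {set {set S}} :=
  [set B : {set S} | (2 < #|B|)%N && `[< exists2 P, is_plane P & B = trace P >]].
have PPP (B : {set S}) : B \in PP -> (2 < #|B|)%N /\ exists2 P, is_plane P & B = trace P.
  by rewrite inE => /andP[-> /asboolP].
have traceE P z : (z \in trace P) = `[< P (val z) >].
  by rewrite inE; apply/idP/asboolP => [/set_mem|/mem_set].
have card_trace P : #|trace P| = #|` points_on S P|%fset.
  rewrite -(card_fsub (A := points_on S P) (B := S)).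
    by apply: eq_card => z; rewrite !inE /= fsvalP.
  by apply/fsubsetP => z; rewrite !inE => /andP[].
have cardT : #|{: S}| = n by rewrite -hS cardfE.
have minor_ex (p q r : S) : p != q -> p != r -> q != r ->
    exists t, minor t (val q - val p) (val r - val p) != 0.
  move=> pq pr qr; apply: exists_minor; first by rewrite (inj_eq val_inj).
  by apply: hcol; rewrite ?(inj_eq val_inj) //; apply: valP.
have [t [hb hm]] := exists_generic val_inj minor_ex.
have plane_eq P (p q r : S) : is_plane P -> p != q -> p != r -> q != r ->
    p \in trace P -> q \in trace P -> r \in trace P ->
    forall z, P z <-> volume t (val q - val p) (val r - val p) (z - val p) = 0.
  rewrite !traceE => hP pq pr qr /asboolP pP /asboolP qP /asboolP rP.
  by apply: plane_span => //; apply: hm.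
have card_ge3 (B : {set S}) : B \in PP -> (2 < #|B|)%N by case/PPP.
have through (a b c : S) : a != b -> a != c -> b != c ->
    exists B : {set S}, [/\ B \in PP, a \in B, b \in B & c \in B].
  move=> ab ac bc; have m0 := hm a b c ab ac bc.
  set P := [set z | z - val a \in <<[:: val b - val a; val c - val a]>>%VS]%classic.
  have aP : a \in trace P by rewrite traceE; apply/asboolP; rewrite /P /= subrr mem0v.
  have bP : b \in trace P.
    by rewrite traceE; apply/asboolP; apply: memv_span; rewrite mem_head.
  have cP : c \in trace P.
    by rewrite traceE; apply/asboolP; apply: memv_span; rewrite !inE eqxx orbT.
  exists (trace P); split=> //; rewrite inE; apply/andP; split.
    by apply/card_gt2P; exists a, b, c; split=> //; split=> //; rewrite eq_sym.
  by apply/asboolP; exists P => //; apply: is_plane_span m0.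
have memB (B : {set S}) (a b c l : S) : B \in PP -> a != b -> a != c -> b != c ->
    a \in B -> b \in B -> c \in B ->
    (l \in B) = (volume t (val b - val a) (val c - val a) (val l - val a) == 0).
  move=> /PPP [_ [P hP ->]] ab ac bc aP bP cP; rewrite traceE.
  by apply/asboolP/eqP; rewrite (plane_eq P a b c).
have unique (B B' : {set S}) (a b c : S) : B \in PP -> B' \in PP ->
    a != b -> a != c -> b != c -> a \in B -> b \in B -> c \in B ->
    a \in B' -> b \in B' -> c \in B' -> B = B'.
  move=> BV BV' ab ac bc aB bB cB aB' bB' cB'; apply/setP => l.
  by rewrite (memB B a b c) // (memB B' a b c).
have max (B : {set S}) : B \in PP -> (#|B| <= #|{: S}| - k)%N.
  by move=> /PPP [_ [P hP ->]]; rewrite cardT card_trace; apply: hplane.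
have mel := sum_planes_through_le hb hm card_ge3 through memB.
have main := card_planes_ge card_ge3 through unique hk.
rewrite cardT in main mel max; have {}main := main hn' max mel.
have num : (#|PP| <= num_determined_planes S)%N.
  have [g gP] : {g : {set S} -> set 'rV[R]_3 & forall B, B \in PP ->
      is_plane (g B) /\ B = trace (g B)}.
    apply: (@boolp.choice _ _ (fun B P => B \in PP -> is_plane P /\ B = trace P)) => B.
    case: (boolP (B \in PP)) => [/PPP [_ [P hP eB]]|_]; last by exists classical_sets.set0.
    by exists P.
  (* Needed because [fset_set] is empty on infinite sets. A determined plane equals the plane that
     [g] chooses for its trace, as three common points fix it. *)
  have fin : finite_set (determined_planes S).
    apply: (sub_finite_set (B := (g @` [set` PP])%classic)); last first.
      exact: finite_image.
    move=> P [hP]; rewrite -card_trace => h3; exists (trace P).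
      by rewrite /= inE h3; apply/asboolP; exists P.
    have tP : trace P \in PP by rewrite inE h3; apply/asboolP; exists P.
    have [gpl ge] := gP _ tP.
    have [a [b [c [[aP bP cP] [ab bc ca]]]]] := card_gt2P h3.
    have ac : a != c by rewrite eq_sym.
    apply/seteqP; split=> z; rewrite (plane_eq P a b c) // (plane_eq (g (trace P)) a b c) //;
      by rewrite -?ge.
  rewrite /num_determined_planes cardE -(size_map g).
  apply: uniq_leq_size.
    rewrite map_inj_in_uniq ?enum_uniq // => B B'.
    by rewrite !mem_enum => /gP [_ e] /gP [_ e'] gBB'; rewrite e gBB' -e'.
  move=> _ /mapP [B + ->]; rewrite mem_enum => BV; have [hB eB] := gP _ BV.
  by rewrite in_fset_set //; apply/mem_set; split=> //; rewrite -card_trace -eB card_ge3.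
have {}main : (4 + k * (n - k) * (2 * n - 3 * k - 1) <= 4 * num_determined_planes S)%N.
  by apply: leq_trans main _; rewrite leq_mul2l num.
(* Four times the claim is [main], since [2 (n - k - 1) - (k - 1) = 2 n - 3 k - 1]. *)
move: main; rewrite -(ler_nat R) natrD !natrM !natrB; try lia.
rewrite !natrM !bin2R natrB //.
set X := n%:R; set Y := k%:R; set Z := (num_determined_planes S)%:R; lra.
Qed.
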